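(* Let $X$ be a Hausdorff topological space which is monotonically normal and cellular-Lindelöf. Then $X$ is Lindelöf.
   Context: A cellular family in a topological space $X$ is a family of pairwise disjoint non-empty open subsets of $X$. A space $X$ is called cellular-Lindelöf if for every cellular family $\mathcal{U}$ in $X$ there is a Lindelöf subspace $L$ of $X$ such that $U \cap L \neq \emptyset$ for every $U \in \mathcal{U}$. For a topological space $(X,\tau)$, let $\mathcal{U}(X)$ be the set of all pairs $(x,U)$ where $U$ is open in $X$ and $x \in U$. The space $(X,\tau)$ is called monotonically normal if there exists an operator $H: \mathcal{U}(X) \to \tau$ such that: (1) $x \in H(x,U) \subset U$ for every $(x,U) \in \mathcal{U}(X)$; (2) for all $(x,U),(y,V)\in\mathcal{U}(X)$, if $H(x,U) \cap H(y,V) \neq \emptyset$ then $x \in V$ or $y \in U$. *)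

(* Defs.v *)
From mathcomp Require Import all_boot all_classical topology.

Set Implicit Arguments.
Unset Strict Implicit.
Unset Printing Implicit Defensive.

Local Open Scope classical_set_scope.

Definition lindelof_space (X : topologicalType) : Prop :=
  forall C : set (set X),
    C `<=` open -> \bigcup_(U in C) U = [set: X] ->
    exists D : set (set X),
      [/\ D `<=` C, countable D & \bigcup_(U in D) U = [set: X]].

Definition cellular_family (X : topologicalType) (C : set (set X)) : Prop :=
  [/\ C `<=` open, (forall U, C U -> U !=set0) & trivIset C id].

(* [set_type L] is the type of points of [L] with the initial topology of the
   inclusion; [subspace L] would keep the points outside [L] as isolated
   points, so it is not the subspace meant here. *)
Definition cellular_lindelof (X : topologicalType) : Prop :=
  forall C : set (set X), cellular_family C ->
    exists2 L : set X, lindelof_space (set_type L) &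
      forall U, C U -> U `&` L !=set0.

(* The operator is defined on pairs (x, U) with U open and x in U; here [H] is
   a total function which is constrained on those pairs only. *)
Definition monotonically_normal (X : topologicalType) : Prop :=
  exists H : X -> set X -> set X,
    (forall x U, open U -> U x ->
       [/\ open (H x U), H x U x & H x U `<=` U]) /\
    (forall x U y V, open U -> U x -> open V -> V y ->
       H x U `&` H y V !=set0 -> V x \/ U y).

(* Main.v *)
Require Import Defs.
From mathcomp Require Import all_boot all_classical topology separation_axioms.
From mathcomp Require Import wochoice.

(** Monotone normality expands a discrete set to a cellular family, so
    cellular-Lindelöfness makes every discrete set, for every open cover,
    covered by countably many members of it.

    Given neighbourhoods [W y], let [K d] be the set of the [y] with
    [d \in W y]. If each [K d] lies in an open set [G d], then picking points
    [d] greedily, each outside the earlier [G d], yields a closed discrete set, which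
    is countable; hence countably many [G d] cover the space.

    Well-order an open cover and show by induction that closed subsets of its
    initial unions [U i] are covered by countably many members. If no countably
    many [U i] cover such a closed set, then with [W y = H y (H y (U i))], [i]
    minimal with [y \in U i], every [K d] lies in a single [U i]: some discrete
    subset [E] of [{y | d \in H y (U i)}] lies in one [U p] and is dense in
    this set outside [U p], and monotone normality puts [E] in [H y (U i)] for
    each [y] of [K d] outside [U p]. This is a contradiction. If countably many
    [U i] suffice, then away from countably many members of the cover, each
    [K d] splits into countably many parts, each inside a single member. *)

Set Implicit Arguments.
Unset Strict Implicit.
Unset Printing Implicit Defensive.

Local Open Scope classical_set_scope.

(** * Well-orders and greedy selection *)

Lemma well_founded_order (T : eqType) : exists lt : T -> T -> Prop,
  [/\ well_founded lt, forall x y, [\/ x = y, lt x y | lt y x] &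
      forall x y z, lt x y -> lt y z -> lt x z].
Proof.
have [R woR] := well_ordering_principle T.
have chR : wo_chain R predT by move=> A _; exact: woR.
have totR x y : R x y || R y x by apply: (wo_chainW chR).
have antiR x y : R x y -> R y x -> x = y.
  by move=> xy yx; apply: (wo_chain_antisymmetric chR) => //; apply/andP.
have wfR : well_founded (fun x y => ~~ R y x).
  move=> x; apply: contrapT => nx.
  pose A := [pred z | `[< ~ Acc (fun x y => ~~ R y x) z >]].
  have [|m [[mP mmin] _]] := woR A.
    by exists x; apply/asboolP.
  move/asboolP: mP; apply; constructor => y; rewrite -[_ y](@negbK (R m y)).
  move=> /negP nmy; apply: contrapT => ny; apply: nmy; rewrite negbK.
  by apply: mmin; apply/asboolP.
have tri x y : [\/ x = y, ~~ R y x | ~~ R x y].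
  have [xy|] := boolP (R x y); last by constructor 3.
  have [yx|] := boolP (R y x); last by constructor 2.
  by constructor 1; apply: antiR.
exists (fun x y => ~~ R y x); split => // x y z yx zy.
apply/negP => zx.
have {}xy : R x y by have := totR x y; rewrite (negbTE yx) orbF.
have {}yz : R y z by have := totR y z; rewrite (negbTE zy) orbF.
(* A failure of transitivity gives a cycle [R x y], [R y z], [R z x]; the least of the three points
   refutes it. *)
have [|m [[mP mmin] _]] := woR [pred t | (t == x) || (t == y) || (t == z)].
  by exists x; rewrite inE eqxx.
have mx : R m x by apply: mmin; rewrite inE eqxx.
have my : R m y by apply: mmin; rewrite inE eqxx orbT.
have mz : R m z by apply: mmin; rewrite inE eqxx orbT.
move: mP; rewrite inE => /orP[/orP[]|] /eqP mE; subst m.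
- by rewrite (antiR _ _ zx mz) xy in zy.
- by rewrite mx in yx.
- by rewrite my in zy.
Qed.

Lemma well_founded_min (T : Type) (lt : T -> T -> Prop) (A : set T) :
  well_founded lt -> A !=set0 -> exists2 m, A m & forall y, A y -> ~ lt y m.
Proof.
move=> wf [x]; elim/(well_founded_ind wf): x => x IH Ax.
have [[y [Ay yx]]|nx] := pselect (exists y, A y /\ lt y x); first exact: IH Ay.
by exists x => // y Ay yx; apply: nx; exists y.
Qed.

Lemma well_founded_irrefl (T : Type) (lt : T -> T -> Prop) x :
  well_founded lt -> ~ lt x x.
Proof.
move=> wf xx; have [|_ -> /(_ x)] := @well_founded_min _ lt [set x] wf.
  by exists x.
exact.
Qed.

(** Well-founded recursion on membership: whether [x] is selected is decided by the points selected
    before it. *)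
Lemma greedy_set (T : Type) (lt : T -> T -> Prop) (P : set T -> T -> Prop) :
  well_founded lt ->
  exists E : set T, forall x, E x <-> P [set y | E y /\ lt y x] x.
Proof.
move=> wf.
(* [IH] is available only below [x], so the proof [h] of [lt y x] is quantified inside the set. *)
pose F x (IH : forall y, lt y x -> Prop) := P [set y | exists h, IH y h] x.
exists (Fix wf (fun=> Prop) F) => x.
rewrite Fix_eq; last first.
  move=> {}x f g fg; congr P.
  by apply/seteqP; split=> y [h]; exists h; [rewrite -fg|rewrite fg].
rewrite {1}/F; set A := (X in P X x); set B := (X in _ <-> P X x).
suff -> : A = B by [].
by apply/seteqP; split=> y; [case|case=> ? h; exists h].
Qed.

(** * Neighbourhood assignments and countable covers *)

Definition nbhd_assignment (X : topologicalType) (C : set X)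
    (o : X -> set X) : Prop :=
  forall x, C x -> open (o x) /\ o x x.

Definition countably_covered (X : topologicalType) (C : set X)
    (o : X -> set X) (S : set X) : Prop :=
  exists D : set X, [/\ D `<=` C, countable D & S `<=` \bigcup_(x in D) o x].

(** The condition in [monotonically_normal] with its operator named, so that successive lemmas share
    one [H]. *)
Definition mn_operator (X : topologicalType) (H : X -> set X -> set X) : Prop :=
  (forall x U, open U -> U x ->
     [/\ open (H x U), H x U x & H x U `<=` U]) /\
  (forall x U y V, open U -> U x -> open V -> V y ->
     H x U `&` H y V !=set0 -> V x \/ U y).

(** Discreteness in the subspace topology: limit points outside [E] are allowed. *)
Definition relatively_discrete (X : topologicalType) (E : set X) : Prop :=
  exists2 N, nbhd_assignment E N &
    forall e e', E e -> E e' -> N e e' -> e = e'.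

Lemma countable_setU (T : Type) (A B : set T) :
  countable A -> countable B -> countable (A `|` B).
Proof.
move=> cA cB; rewrite -bigcup2E; apply: bigcup_countable => // -[//|[//|n]] _.
exact: finite_set_countable.
Qed.

Lemma countable_preimage_choice (T U : Type) (I : set T) (f : T -> U)
    (D : set U) : countable D -> D `<=` f @` I ->
  exists D' : set T, [/\ D' `<=` I, countable D' & D `<=` f @` D'].
Proof.
move=> cD DfI.
(* [None] is the value off [D], since [T] may be empty. *)
have /choice[g gP] (u : U) : exists t : option T,
    D u -> exists2 x, t = Some x & I x /\ f x = u.
  have [/DfI[x Ix fx]|nDu] := pselect (D u); last by exists None.
  by exists (Some x); exists x.
exists (\bigcup_(u in D) [set x | g u = Some x]); split.
- by move=> x [u /gP[y -> [Iy _]] [<-]].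
- apply: bigcup_countable => // u /gP[x gu _].
  apply: sub_countable (countable1 x); apply: subset_card_le => y.
  by rewrite /= gu => -[].
- by move=> u Du; have [x gu [_ fx]] := gP _ Du; exists x => //; exists u.
Qed.

Lemma lindelof_subspace_cover (X : topologicalType) (L I : set X)
    (W : X -> set X) :
  lindelof_space (set_type L) -> (forall x, I x -> open (W x)) ->
  L `<=` \bigcup_(x in I) W x -> countably_covered I W L.
Proof.
move=> lindL oW LW.
pose f x : set (set_type L) := val @^-1` (W x).
have [|| D [DfI cD Dcov]] := lindL (f @` I).
- move=> _ [x Ix <-]; apply: open_comp; last exact: oW.
  by move=> ? _; exact: initial_continuous.
- apply/seteqP; split=> // l _.
  by have [x Ix Wxl] := LW _ (set_valP l); exists (f x) => //; exists x.
have [D' [D'I cD' DD']] := countable_preimage_choice cD DfI.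
exists D'; split=> // x Lx.
have : [set: set_type L] (SigSub (mem_set Lx)) by [].
by rewrite -Dcov => -[_ /DD'[y D'y <-]]; exists y.
Qed.

(** * Discrete sets in cellular-Lindelöf spaces *)

(** The [V e] are a disjoint open expansion of [E], and some Lindelöf [L] meets every smaller set
    [H e (V e)]. Cover [L] by the [V e] and, at its points outside their union, by sets [H x (o x)].
    A member of a countable subcover meeting [H e (V e)] is either [V e] itself or an [H x (o x)]
    with [x] outside [V e], and then monotone normality puts [e] in [o x]. *)
Lemma discrete_countably_covered_setT (X : topologicalType) H (E : set X) o :
  @mn_operator X H -> cellular_lindelof X -> relatively_discrete E ->
  nbhd_assignment [set: X] o -> countably_covered [set: X] o E.
Proof.
move=> [H1 H2] clX [N NE Ndisc] oP.
have oV e (Ee : E e) := H1 e (N e) (NE e Ee).1 (NE e Ee).2.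
pose V e := H e (N e).
have oV' e : E e -> [/\ open (H e (V e)), H e (V e) e & H e (V e) `<=` V e].
  by move=> Ee; have [? ? _] := oV _ Ee; exact: H1.
have Vdisj e e' : E e -> E e' -> V e `&` V e' !=set0 -> e = e'.
  move=> Ee Ee' VV; have [oN Ne] := NE e Ee; have [oN' Ne'] := NE e' Ee'.
  by case: (H2 _ _ _ _ oN Ne oN' Ne' VV) => [/Ndisc->//|/Ndisc]; exact.
have [|L lindL LV] := clX [set H e (V e) | e in E].
  split.
  - by move=> _ [e /oV'[? ? _] <-].
  - by move=> _ [e /oV'[_ ? _] <-]; exists e.
  - move=> _ _ [e Ee <-] [e' Ee' <-] [z [z1 z2]].
    have [_ _ V'V] := oV' _ Ee; have [_ _ V'V'] := oV' _ Ee'.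
    by rewrite (Vdisj e e') //; exists z; split; [exact: V'V|exact: V'V'].
pose W x := if `[< E x >] then V x else H x (o x).
pose Z := [set x | forall e, E e -> ~ V e x].
have [|| D [DI cD LD]] := @lindelof_subspace_cover X L (E `|` Z) W lindL.
- move=> x EZx; rewrite /W; case: asboolP => [/oV[]//|_].
  by have [? ?] := oP x I; case: (H1 x (o x)).
- move=> l Ll; have [[e [Ee Vel]]|nl] := pselect (exists e, E e /\ V e l).
    by exists e; [left|rewrite /W asboolT].
  have Zl : Z l by move=> e Ee Vel; apply: nl; exists e.
  exists l; first by right.
  rewrite /W asboolF; first by have [? ?] := oP l I; case: (H1 l (o l)).
  by move=> El; case: (oV _ El) => _ /(Zl _ El).
exists D; split=> // e Ee.
have [_ l] := oV' _ Ee.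
have [|z [V'z /LD[x Dx]]] := LV (H e (V e)); first by exists e.
have [ox xx] := oP x I; have [oe ee _] := oV _ Ee.
rewrite /W; case: asboolP => [Ex Vxz|nEx Hxz].
  rewrite (_ : e = x); first by exists x.
  by apply: Vdisj => //; exists z; split=> //; case: (oV' _ Ee) => _ _; exact.
have [//|Zx] := DI _ Dx.
have [|/(Zx _ Ee)//|oxe] := H2 x (o x) e (V e) ox xx oe ee; first by exists z.
by exists x.
Qed.

(** Off [C] the assignment is extended by the complement of [C], which misses [E]; so the centres in
    [C] suffice. *)
Lemma discrete_countably_covered (X : topologicalType) H (C E : set X) o :
  @mn_operator X H -> cellular_lindelof X -> closed C -> E `<=` C ->
  relatively_discrete E -> nbhd_assignment C o -> countably_covered C o E.
Proof.
move=> mnH clX cC EC Ed oP.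
have [|D [_ cD ED]] := discrete_countably_covered_setT mnH clX Ed
  (o := fun x => if `[< C x >] then o x else ~` C).
  move=> x _; case: asboolP => [/oP//|Cx]; split=> //; exact: closed_openC.
exists (D `&` C); split.
- by move=> x [].
- by apply: sub_countable cD; apply: subset_card_le => x [].
- move=> e Ee; have [x Dx] := ED _ Ee.
  by case: asboolP => [Cx oxe|_ []]; [exists x|exact: EC].
Qed.

(** * Covers dominating a neighbourhood assignment *)

Lemma countable_atmost1_image (T U : Type) (D : set T) (E : set U)
    (f : T -> set U) : countable D ->
  (forall x, D x -> forall a b, f x a -> f x b -> E a -> E b -> a = b) ->
  E `<=` \bigcup_(x in D) f x -> countable E.
Proof.
move=> cD f1 EDf.
have -> : E = \bigcup_(x in D) (E `&` f x).
  apply/seteqP; split=> [a Ea|a [x _ []]//].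
  by have [x Dx fx] := EDf _ Ea; exists x.
apply: bigcup_countable => // x Dx; apply: finite_set_countable.
have [[a [Ea fa]]|n] := pselect (exists a, E a /\ f x a).
  apply: (@sub_finite_set _ _ [set a]) => // b [Eb fb]; exact: (f1 x).
by apply: (@sub_finite_set _ _ set0) => // b Eb; apply: n; exists b.
Qed.

(** Let [E] be greedy for [G], and [m y] the first [e] in [E] with [G e y]. Then [N y] contains no
    point of [E] except possibly [m y]: an earlier [e] in [W y] would satisfy [G e y], and a later
    one avoids [G (m y)]. So [E] is discrete, and a countable cover of [E] by sets [N y] makes it
    countable. *)
Lemma countable_dominating_cover (X : topologicalType) H (F : set X) W G :
  @mn_operator X H -> cellular_lindelof X -> closed F ->
  nbhd_assignment F W -> (forall d, F d -> open (G d)) ->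
  (forall d y, F d -> F y -> W y d -> G d y) ->
  countably_covered F G F.
Proof.
move=> mnH clX cF WP oG WG.
have [lt [wf tri trans]] := well_founded_order X.
have [E EP] := greedy_set (fun S x => F x /\ forall e, S e -> ~ G e x) wf.
have EF : E `<=` F by move=> x /EP[].
have FG y : F y -> exists2 e, E e & G e y.
  move=> Fy; apply: contrapT => nG.
  (* A point missed by every [G e] passes the greedy test, yet [W y y] gives [G y y]. *)
  have Ey : E y by apply/EP; split=> // e [Ee _] Gey; apply: nG; exists e.
  by apply: nG; exists y => //; apply: WG => //; exact: (WP _ Fy).2.
have /choice[m mP] (y : X) : exists e, F y ->
    [/\ E e, G e y & forall e', E e' -> G e' y -> ~ lt e' e].
  have [Fy|] := pselect (F y); last by exists y.
  have [|e [Ee Gey] emin] := @well_founded_min _ lt [set e | E e /\ G e y] wf.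
    by have [e] := FG _ Fy; exists e.
  by exists e => _; split=> // e' *; apply: emin.
pose N y := W y `&` G (m y).
have NP : nbhd_assignment F N.
  move=> y Fy; have [? ?] := WP _ Fy; have [Em Gm _] := mP _ Fy.
  by split; [apply: openI => //; apply/oG/EF|].
have N1 y e : F y -> E e -> N y e -> e = m y.
  move=> Fy Ee [Wye Ge]; have [Em Gm mmin] := mP _ Fy.
  have [//|em|me] := tri e (m y).
    by case: (mmin _ Ee _ em); exact: WG (EF _ Ee) Fy Wye.
  by have /EP[_ /(_ (m y))] := Ee; case.
have Ed : relatively_discrete E.
  exists N; first by move=> e /EF /NP.
  move=> e e' Ee Ee' Nee'; rewrite (N1 _ _ (EF _ Ee) Ee' Nee').
  by apply: N1 => //; [exact: EF|exact: (NP _ (EF _ Ee)).2].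
have [D [DF cD ED]] := discrete_countably_covered mnH clX cF EF Ed NP.
exists E; split=> //.
apply: (countable_atmost1_image cD _ ED) => y Dy a b Na Nb Ea Eb.
by rewrite (N1 y a (DF _ Dy) Ea Na) (N1 y b (DF _ Dy) Eb Nb).
Qed.

(** * Covers by a chain of open sets *)

(** For [z] in the closure but outside [U], applying [H] to [z] and the complement of [x] gives a
    set meeting [H x U], against monotone normality. *)
Lemma mn_closure_sub (X : topologicalType) H (x : X) U :
  hausdorff_space X -> mn_operator H -> open U -> U x -> closure (H x U) `<=` U.
Proof.
move=> hX [H1 H2] oU Ux z clz; apply: contrapT => nUz.
have oC : open (~` [set x]).
  exact/closed_openC/accessible_closed_set1/hausdorff_accessible.
have zx : (~` [set x]) z by move=> /= zx; apply: nUz; rewrite zx.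
have [oHz Hz _] := H1 z _ oC zx.
have HH : H x U `&` H z (~` [set x]) !=set0.
  by apply: clz; exact: open_nbhs_nbhs.
by case: (H2 _ _ _ _ oU Ux oC zx HH) => [/(_ erefl)|/nUz].
Qed.

(** To be used with [N y] the first set containing [y] in a well-ordered increasing family. If the
    conclusion fails, each [d] in [C] has a single [N (q d)] containing all [y] in [C] with
    [W' y d], and [countable_dominating_cover] applies. *)
Lemma chain_countably_covered (X : topologicalType) H (C : set X) N :
  hausdorff_space X -> @mn_operator X H -> cellular_lindelof X -> closed C ->
  nbhd_assignment C N ->
  (forall x y, C x -> C y -> N x `<=` N y \/ N y `<=` N x) ->
  (forall x y, C x -> C y -> N y x -> N x `<=` N y) ->
  countably_covered C N C.
Proof.
move=> hX mnH clX cC NP Nchain Nmin; apply: contrapT => nC.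
(* A point [p] missed by countably many [N y] has [N p] above them all in the chain. *)
have bounded D : D `<=` C -> countable D ->
    exists2 p, C p & forall y, D y -> N y `<=` N p.
  move=> DC cD; apply: contrapT => nb; apply: nC; exists D; split=> // p Cp.
  apply: contrapT => nDp; apply: nb; exists p => // y Dy.
  have [//|pNy] := Nchain y p (DC _ Dy) Cp.
  by case: nDp; exists y => //; apply: pNy; case: (NP p Cp).
have [H1 H2] := mnH.
pose W y := H y (N y); pose W' y := H y (W y).
have WP y : C y -> [/\ open (W y), W y y & W y `<=` N y].
  by move=> /NP[oN Ny]; exact: H1.
have W'P y : C y -> [/\ open (W' y), W' y y & W' y `<=` W y].
  by move=> /WP[oN Ny _]; exact: H1.
have /choice[q qP] d : exists q, C d ->
    C q /\ forall y, C y -> W' y d -> N q y.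
  have [Cd|] := pselect (C d); last by exists d.
  have [lt [wf tri _]] := well_founded_order X.
  (* The last condition keeps later points out of [N e]; the closure condition lets a neighbourhood
     exclude the earlier ones. Together they make [E] discrete. *)
  pose P S x := [/\ C x, W x d, ~ closure S x & forall e, S e -> ~ N e x].
  have [E EP] := greedy_set P wf.
  have EC : E `<=` C by move=> x /EP[].
  have Ed : relatively_discrete E.
    exists (fun e => N e `&` ~` closure [set z | E z /\ lt z e]).
      move=> e Ee; have [Ce _ ncl _] := (EP e).1 Ee; have [oN Ne] := NP e Ce.
      by split=> //; apply: openI => //; exact/closed_openC/closed_closure.
    move=> e e' Ee Ee' [Nee' ncle'].
    have [//|ee'|e'e] := tri e e'.
      by have [_ _ _ /(_ e)[]] := (EP e').1 Ee'.
    by case: ncle'; apply: subset_closure.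
  have [D [DC cD ED]] := discrete_countably_covered mnH clX cC EC Ed NP.
  have [p Cp Dp] := bounded D DC cD.
  have Ep : E `<=` N p by move=> e /ED[x /Dp xp]; exact: xp.
  have Wsub x : C x -> W x d -> (closure E `|` N p) x.
    move=> Cx Wxd; have [Ex|nEx] := pselect (E x).
      by left; exact: subset_closure.
    apply: contrapT => /not_orP[nclx nNx]; apply: nEx; apply/EP; split=> //.
      by move=> clx; apply: nclx; apply: closure_subset clx => z [].
    move=> e [Ee _] Nex; apply: nNx.
    exact: (Nmin e p (EC _ Ee) Cp (Ep _ Ee)).
  (* If some [y] with [W' y d] escapes [N p], then [y] itself serves as [q]: [E] lies in [W y],
     whose closure is inside [N y], and [N p] lies in [N y] by the chain condition. *)
  have [[y [Cy W'yd nNy]]|npC] :=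
    pselect (exists y, [/\ C y, W' y d & ~ N p y]); last first.
    exists p => _; split=> // y Cy W'yd; apply: contrapT => nNy.
    by apply: npC; exists y.
  exists y => _; split=> // x Cx W'xd.
  have EW : E `<=` W y.
    move=> e Ee; have [Ce Wed _ _] := (EP e).1 Ee.
    have [oe Ne] := NP e Ce; have [oW Wy _] := WP y Cy.
    have [|//|Ney] := H2 e (N e) y (W y) oe Ne oW Wy; first by exists d.
    by case: nNy; exact: (Nmin e p Ce Cp (Ep _ Ee)).
  have [oy Ny] := NP y Cy.
  have pNy : N p `<=` N y.
    by have [//|yp] := Nchain p y Cp Cy; case: nNy; exact: yp.
  have [_ _ W'W] := W'P x Cx.
  have [clx|/pNy//] := Wsub x Cx (W'W _ W'xd).
  exact: (mn_closure_sub hX mnH oy Ny (closure_subset EW clx)).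
have [|||D [DC cD CD]] :=
  @countable_dominating_cover X H C W' (N \o q) mnH clX cC.
- by move=> x /W'P[].
- by move=> d /qP[/NP[]].
- by move=> d y Cd; case: (qP d Cd) => _; exact.
apply: nC; exists (q @` D); split.
- by move=> _ [d /DC/qP[? _] <-].
- exact: sub_countable (card_image_le _ _) cD.
- by move=> x /CD[d Dd Nx]; exists (q d) => //; exists d.
Qed.

(** * Countable unions of well-covered open sets *)

(** The points [d] where the part of index [k] fits in no single member form a set whose closure
    lies in [A k], hence is countably covered. Away from these covers, countably many members
    contain every [y] in [C] with [W y d]. *)
Lemma closed_countable_bigcup_covered (X : topologicalType) H o (C D : set X)
    A :
  @mn_operator X H -> cellular_lindelof X -> nbhd_assignment [set: X] o ->
  closed C -> countable D -> (forall k, D k -> open (A k)) ->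
  (forall k B, D k -> closed B -> B `<=` A k -> countably_covered setT o B) ->
  C `<=` \bigcup_(k in D) A k -> countably_covered setT o C.
Proof.
move=> mnH clX oP cC cD oA Acov CA; have [H1 H2] := mnH.
have /choice[n nP] y : exists k, C y -> D k /\ A k y.
  by have [/CA[k]|] := pselect (C y); [exists k|exists y].
pose W y := H y (A (n y)).
have WP : nbhd_assignment C W.
  by move=> y Cy; have [Dn An] := nP y Cy; case: (H1 y (A (n y)) (oA _ Dn) An).
(* Near a point [y] outside [A k], the part of [{x | W x d}] of index [k] is
   contained in [o y]. *)
pose Q k := [set d | C d /\
  forall z, exists x, [/\ C x, W x d, n x = k & ~ o z x]].
have QA k : D k -> closure (Q k) `<=` A k.
  move=> Dk y clQy; apply: contrapT => nAy; have [oy yy] := oP y I.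
  have [oHy Hy _] := H1 y _ oy yy.
  have [d [[Cd /(_ y)[x [Cx Wxd nx noyx]]] Hyd]] :=
    clQy _ (open_nbhs_nbhs (conj oHy Hy)).
  have [_ Ax] := nP x Cx; rewrite /W nx in Wxd Ax.
  have [|/noyx|/nAy] // := H2 x (A k) y (o y) (oA k Dk) Ax oy yy.
  by exists d.
have /choice[T TP] k : exists T, D k ->
    countable T /\ closure (Q k) `<=` \bigcup_(x in T) o x.
  have [Dk|] := pselect (D k); last by exists set0.
  have [T [_ cT QT]] := Acov k _ Dk (@closed_closure _ (Q k)) (QA k Dk).
  by exists T.
pose S := \bigcup_(k in D) T k.
have cS : countable S by apply: bigcup_countable => // k /TP[].
pose F := C `&` ~` \bigcup_(x in S) o x.
have cF : closed F.
  apply: closedI => //; apply: open_closedC; apply: bigcup_open => x _.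
  exact: (oP x I).1.
have /choice[z zP] d : exists z : X -> X, F d ->
    forall x, C x -> W x d -> o (z (n x)) x.
  have [[Cd nSd]|] := pselect (F d); last by exists id.
  have /choice[z zP] k : exists z,
      D k -> forall x, C x -> W x d -> n x = k -> o z x.
    have [Dk|] := pselect (D k); last by exists d.
    apply: contrapT => nz; apply: nSd.
    have [_ /(_ d)[]] := TP k Dk.
      apply: subset_closure; split=> // z; apply: contrapT => nx.
      apply: nz; exists z => _ x Cx Wxd nxk; apply: contrapT => nozx.
      by apply: nx; exists x.
    by move=> x Tx oxd; exists x => //; exists k.
  by exists z => _ x Cx Wxd; have [Dn _] := nP x Cx; exact: zP.
(* Each [G d] unites countably many members, so countably many [G d] still cost only countably many
   members. *)
pose G d := \bigcup_(k in D) o (z d k).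
have [|||E [EF cE FE]] := @countable_dominating_cover X H F W G mnH clX cF.
- by move=> x [Cx _]; exact: WP.
- by move=> d _; apply: bigcup_open => k _; case: (oP (z d k) I).
- move=> d y Fd [Cy _] Wyd; have [Dn _] := nP y Cy.
  by exists (n y) => //; exact: zP.
exists (S `|` \bigcup_(e in E) (z e @` D)); split=> //.
- apply: countable_setU => //; apply: bigcup_countable => // e _.
  exact: sub_countable (card_image_le _ _) cD.
- move=> x Cx; have [[y Sy oyx]|nSx] := pselect ((\bigcup_(y in S) o y) x).
    by exists y => //; left.
  have [e Ee [k Dk ox]] := FE x (conj Cx nSx).
  by exists (z e k) => //; right; exists e => //; exists k.
Qed.

(** * Transfinite induction along a well-ordered cover *)

Lemma nbhd_assignment_countable (X : topologicalType) H (o : X -> set X) :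
  hausdorff_space X -> @mn_operator X H -> cellular_lindelof X ->
  nbhd_assignment [set: X] o -> countably_covered setT o [set: X].
Proof.
move=> hX mnH clX oP.
have [lt [wf tri trans]] := well_founded_order X.
pose U x := \bigcup_(z in [set z | z = x \/ lt z x]) o z.
have oU x : open (U x) by apply: bigcup_open => z _; case: (oP z I).
have leU x y : ~ lt y x -> U x `<=` U y.
  move=> nyx t [z zx ozt]; exists z => //.
  have [xy|xy|//] := tri x y; first by rewrite -xy.
  by right; case: zx => [->//|/trans]; exact.
pose good S := forall C, closed C -> C `<=` S -> countably_covered setT o C.
(* With [r y] the first index in [I] whose [U] contains [y], the sets [U (r y)] form a chain; it is
   first reduced to countably many sets, then these are treated as a countable union. *)
have union I : (forall x, I x -> good (U x)) -> good (\bigcup_(x in I) U x).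
  move=> It C cC CI.
  have /choice[r rP] y : exists i, C y ->
      [/\ I i, U i y & forall j, I j -> U j y -> ~ lt j i].
    have [Cy|] := pselect (C y); last by exists y.
    have [|i [Ii Ui] imin] := @well_founded_min _ lt [set i | I i /\ U i y] wf.
      by have [i Ii Ui] := CI y Cy; exists i.
    by exists i => _; split=> // j Ij Uj; exact: imin.
  have [|||D [DC cD CD]] :=
    @chain_countably_covered X H C (U \o r) hX mnH clX cC.
  - by move=> y /rP[_ Uy _]; split=> //; exact: oU.
  - move=> x y _ _ /=; have [xy|] := pselect (lt (r y) (r x)).
      right; apply: leU => yx.
      exact: well_founded_irrefl wf (trans _ _ _ xy yx).
    by left; exact: leU.
  - move=> x y Cx Cy Uyx; apply: leU; have [_ _] := rP x Cx; apply => //.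
    by case: (rP y Cy).
  apply: (@closed_countable_bigcup_covered X H o C (r @` D) U) => //.
  - exact: sub_countable (card_image_le _ _) cD.
  - by move=> _ B [d /DC/rP[Ir _ _] <-]; exact: It.
  - by move=> x /CD[d Dd Ux]; exists (r d) => //; exists d.
have Ugood x : good (U x).
  elim/(well_founded_ind wf): x => x IH C cC CU.
  (* Removing [o x] leaves a closed set inside the union of the earlier [U z]. *)
  have [|||D [_ cD CD]] := union [set z | lt z x] _ (C `&` ~` o x).
  - by move=> z zx; exact: IH.
  - by apply: closedI => //; apply: open_closedC; case: (oP x Logic.I).
  - move=> t [/CU[z [->//|zx] ozt] _]; exists z => //.
    by exists z => //; left.
  exists (x |` D); split=> //.
    by apply: countable_setU => //; exact: countable1.
  move=> t Ct; have [oxt|nox] := pselect (o x t); first by exists x => //; left.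
  by have [z Dz ozt] := CD t (conj Ct nox); exists z => //; right.
apply: (union [set: X] (fun x _ => Ugood x) _ closedT).
by move=> x _; exists x => //; exists x; [left|case: (oP x Logic.I)].
Qed.

Theorem theorem6 (X : topologicalType) (hX : hausdorff_space X)
    (mnX : monotonically_normal X) (clX : cellular_lindelof X) :
  lindelof_space X.
Proof.
move=> C oC covC; have [H mnH] := mnX.
(* Choosing a member around each point turns the cover into a neighbourhood assignment. *)
have /choice[o oP] x : exists U, C U /\ U x.
  have : [set: X] x by [].
  by rewrite -covC => -[U CU Ux]; exists U.
have oA : nbhd_assignment [set: X] o by move=> x _; have [/oC] := oP x.
have [D [_ cD DX]] := nbhd_assignment_countable hX mnH clX oA.
exists (o @` D); split.
- by move=> _ [x _ <-]; case: (oP x).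
- exact: sub_countable (card_image_le _ _) cD.
- apply/seteqP; split=> // x /DX[y Dy oyx].
  by exists (o y) => //; exists y.
Qed.
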